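(* There are absolute constants $\varepsilon_0>0$ and $c>0$ such that the following holds. Let $n\le t/100$ and $p\in(0,1]$. Any $k$-pass streaming algorithm $\mathsf{M}$ using $s$ bits of memory that distinguishes $\boldsymbol D_0$ from $\boldsymbol D_1$ with high probability (error rate $\Pr[\mathsf{M}(\boldsymbol D_0)=1]+\Pr[\mathsf{M}(\boldsymbol D_1)=0]\le\varepsilon_0$) satisfies $k\,s\,p^2 n\ge c$.
   Context: Needle problem with domain $[t]$ and stream length $n$. Uniform distribution $\boldsymbol D_0$: $X_1,\dots,X_n$ are i.i.d. uniform on $[t]$. Needle distribution $\boldsymbol D_1$ (with needle probability $p$): first pick $\alpha$ uniformly from $[t]$; then independently for each $i$, $X_i=\alpha$ with probability $p$ and otherwise $X_i$ is uniform on $[t]$. A $k$-pass streaming algorithm reads $X_1,\dots,X_n$ in order $k$ times, may use private randomness, and outputs a bit. *)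

(* Defs.v *)
From HB Require Import structures.
From mathcomp Require Import all_boot all_order all_algebra.
From mathcomp Require Import reals.
Set Implicit Arguments. Unset Strict Implicit. Unset Printing Implicit Defensive.
Import Order.TTheory GRing.Theory Num.Theory.
Local Open Scope ring_scope.

Definition stream (n t : nat) := {ffun 'I_n -> 'I_t}.

(* A k-pass streaming algorithm with s bits of memory (states 'I_(2^s)),
   using private randomness: a random seed w drawn from a finite probability
   space (Omega, mu).  For each seed, the algorithm is deterministic; its
   transition may depend on the pass index and the position in the stream
   (non-uniform model, which only strengthens a lower bound). *)
Record streaming_alg (t n k s : nat) (Omega : finType) := StreamingAlg {
  sa_init : Omega -> 'I_(2 ^ s);
  sa_step : Omega -> 'I_k -> 'I_n -> 'I_(2 ^ s) -> 'I_t -> 'I_(2 ^ s);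
  sa_out  : Omega -> 'I_(2 ^ s) -> bool
}.

Section Run.
Variables (t n k s : nat) (Omega : finType) (M : streaming_alg t n k s Omega).

Definition run_pass (w : Omega) (j : 'I_k) (x : stream n t) (st : 'I_(2 ^ s)) :=
  foldl (fun st i => sa_step M w j i st (x i)) st (enum 'I_n).

Definition run_alg (w : Omega) (x : stream n t) : 'I_(2 ^ s) :=
  foldl (fun st j => run_pass w j x st) (sa_init M w) (enum 'I_k).

Definition alg_output (w : Omega) (x : stream n t) : bool :=
  sa_out M w (run_alg w x).
End Run.

Definition is_distr (R : realType) (Omega : finType) (mu : Omega -> R) :=
  (forall w, 0 <= mu w) /\ \sum_(w : Omega) mu w = 1.

Definition D0_prob (R : realType) (n t : nat) (x : stream n t) : R :=
  \prod_(i < n) (t%:R)^-1.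

(* Probability of stream x under D_1 given needle alpha: independently for
   each i, X_i = alpha w.p. p, otherwise X_i uniform on [t]. *)
Definition D1_cond_prob (R : realType) (n t : nat) (p : R) (alpha : 'I_t)
    (x : stream n t) : R :=
  \prod_(i < n) (p * (x i == alpha)%:R + (1 - p) * (t%:R)^-1).

Definition D1_prob (R : realType) (n t : nat) (p : R) (x : stream n t) : R :=
  \sum_(alpha < t) (t%:R)^-1 * D1_cond_prob p alpha x.

Definition PrD0 (R : realType) (t n k s : nat) (Omega : finType) (mu : Omega -> R)
    (M : streaming_alg t n k s Omega) (b : bool) : R :=
  \sum_(w : Omega) \sum_(x : stream n t)
     mu w * D0_prob R x * (alg_output M w x == b)%:R.

Definition PrD1 (R : realType) (t n k s : nat) (p : R) (Omega : finType)
    (mu : Omega -> R) (M : streaming_alg t n k s Omega) (b : bool) : R :=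
  \sum_(w : Omega) \sum_(x : stream n t)
     mu w * D1_prob p x * (alg_output M w x == b)%:R.

(* Main.v *)
Require Import Defs.
From HB Require Import structures.
From mathcomp Require Import all_boot all_order all_algebra.
From mathcomp Require Import reals exp ring lra zify.
Import Order.TTheory GRing.Theory Num.Theory.
Local Open Scope ring_scope.
Set Implicit Arguments. Unset Strict Implicit. Unset Printing Implicit Defensive.

(** Fix the random seed. Draw a set [H] of positions, each with probability [2 p], and a needle [alpha]; every [i] in [H] then equals [alpha] with probability 1/2 and is uniform otherwise. Averaged over [H] and [alpha] this is the needle distribution, and because of the factor 1/2 all likelihood ratios below are at least 1/2, so their logarithms are controlled.

Cut the stream halfway between consecutive elements of [H], and record the memory states of all passes at the cuts. For a deterministic algorithm, streams with a given record form a rectangle (segments can be exchanged), so the likelihood ratio of the record between "[H] and [alpha]" and "uniform" is a product over [i] in [H], whose factor at [i] is [(1 + t P(X_i = alpha | states at both ends of the segment)) / 2]. Relative entropy is therefore a sum over [i] in [H].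

For fixed cuts [a], [b], the terms of all positions [i] add up to at most the logarithm of the number of pairs of states, i.e. [2 k s ln 2]. Given [i], the pair of midpoint cuts [(a, b)] determines the two neighbours of [i] in [H] up to two choices each, so it has probability [O(p^3 (1 - 2 p)^(b - a))] together with [i] in [H]; summing over [a < b] bounds the relative entropy by [O(k s p^2 n)]. *)

(** * Elementary bounds on the logarithm *)

Lemma ln_le_subr1 (R : realType) (x : R) : 0 < x -> ln x <= x - 1.
Proof.
move=> x0; have := @le_ln1Dx R (x - 1); rewrite addrCA subrr addr0; apply; lra.
Qed.

Lemma subr1_le_mul_ln (R : realType) (x : R) : 0 < x -> x - 1 <= x * ln x.
Proof.
move=> x0; have := @ln_le_subr1 _ x^-1; rewrite invr_gt0 lnV ?posrE// => /(_ x0).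
move=> h; have : x * (- ln x) <= x * (x^-1 - 1) by rewrite ler_wpM2l// ltW.
rewrite mulrBr divff ?gt_eqF//; lra.
Qed.

Lemma ln_prod (R : realType) (I : Type) (r : seq I) (P : pred I) (F : I -> R) :
  (forall i, 0 < F i) ->
  ln (\prod_(i <- r | P i) F i) = \sum_(i <- r | P i) ln (F i).
Proof.
move=> F0; elim: r => [|i r IH]; first by rewrite !big_nil ln1.
by rewrite !big_cons; case: ifP => // _; rewrite lnM ?IH ?posrE ?prodr_gt0.
Qed.

(** * Product measures on streams *)

Section Product.
Variables (R : realType) (n t : nat).
Implicit Types (nu : 'I_n -> 'I_t -> R) (x : stream n t).

Definition pmass nu x : R := \prod_(i < n) nu i (x i).

Definition unif (_ : 'I_n) (_ : 'I_t) : R := t%:R^-1.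

Definition half_hit (H : {set 'I_n}) (alpha : 'I_t) (i : 'I_n) (a : 'I_t) : R :=
  if i \in H then ((a == alpha)%:R + t%:R^-1) / 2 else t%:R^-1.

Lemma sum_pmass nu : \sum_x pmass nu x = \prod_i \sum_a nu i a.
Proof. by rewrite bigA_distr_bigA. Qed.

Hypothesis t0 : (0 < t)%N.

Lemma sum_unif i : \sum_a unif i a = 1.
Proof.
by rewrite /unif sumr_const card_ord -[LHS]mulr_natl mulfV// pnatr_eq0 -lt0n.
Qed.

Lemma sum_delta (alpha : 'I_t) : \sum_(a < t) (a == alpha)%:R = 1 :> R.
Proof. by rewrite (bigD1 alpha)//= eqxx big1 ?addr0// => i /negPf->. Qed.

Lemma sum_half_hit H alpha i : \sum_a half_hit H alpha i a = 1.
Proof.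
case iH: (i \in H); under eq_bigr do rewrite /half_hit iH; last exact: sum_unif i.
by rewrite -mulr_suml big_split/= sum_delta [X in _ + X](sum_unif i); lra.
Qed.

Lemma sum_pmass_unif : \sum_x pmass unif x = 1.
Proof. by rewrite sum_pmass big1// => i _; exact: sum_unif. Qed.

Lemma sum_pmass_half_hit H alpha : \sum_x pmass (half_hit H alpha) x = 1.
Proof. by rewrite sum_pmass big1// => i _; exact: sum_half_hit. Qed.

Lemma pmass_unif_gt0 x : 0 < pmass unif x.
Proof. by apply: prodr_gt0 => i _; rewrite invr_gt0 ltr0n. Qed.

Lemma pmass_half_hit_ge0 H alpha x : 0 <= pmass (half_hit H alpha) x.
Proof.
apply: prodr_ge0 => i _; rewrite /half_hit; case: ifP => _; last by rewrite invr_ge0 ler0n.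
by rewrite divr_ge0// addr_ge0// ?invr_ge0 ler0n.
Qed.

Lemma pmass_half_hit0 alpha x : pmass (half_hit set0 alpha) x = pmass unif x.
Proof. by apply: eq_bigr => i _; rewrite /half_hit inE. Qed.

Lemma pmass_half_hit1 i alpha x :
  pmass (half_hit [set i] alpha) x = pmass unif x * ((x i == alpha)%:R * t%:R + 1) / 2.
Proof.
rewrite /pmass (bigD1 i)//= [in RHS](bigD1 i)//= /half_hit inE eqxx /unif.
rewrite (eq_bigr (fun=> t%:R^-1)) => [|j /negPf ji]; last by rewrite inE ji.
have : (t%:R : R) != 0 by rewrite pnatr_eq0 -lt0n.
by move=> ?; field.
Qed.

End Product.
Arguments unif {R n t}.

(** * Likelihood ratios and relative entropy for a single hit *)

Section Gibbs.
Variables (R : realType) (n t : nat) (C : finType) (f : stream n t -> C).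
Hypothesis t0 : (0 < t)%N.
Implicit Types (c : C) (i : 'I_n) (a : 'I_t) (x : stream n t).
Let E0 (F : stream n t -> R) := \sum_x pmass unif x * F x.

(** The likelihood ratio of the record value [c] between one hit at [i] with needle [a] and the
    uniform law. An unreachable [c] gets 0/0 = 0. *)
Definition lik i a c : R :=
  (\sum_(x | f x == c) pmass (half_hit R [set i] a) x) / (\sum_(x | f x == c) pmass unif x).

Let N c := \sum_(x | f x == c) pmass (@unif R n t) x.
Let Na i a c := \sum_(x | f x == c) pmass (@unif R n t) x * (x i == a)%:R.

Let tr0 : (t%:R : R) != 0. Proof. by rewrite pnatr_eq0 -lt0n. Qed.

Let N_gt0 x : 0 < N (f x).
Proof.
rewrite /N (bigD1 x)//= ltr_wpDr ?pmass_unif_gt0// sumr_ge0// => y _.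
by rewrite ltW// pmass_unif_gt0.
Qed.

Let Na_ge0 i a c : 0 <= Na i a c.
Proof. by rewrite sumr_ge0// => x _; rewrite mulr_ge0// ltW// pmass_unif_gt0. Qed.

Let sum_Na i c : \sum_a Na i a c = N c.
Proof.
rewrite exchange_big; apply: eq_bigr => x _ /=.
rewrite -mulr_sumr (bigD1 (x i))//= eqxx big1 ?addr0 ?mulr1// => a.
by rewrite eq_sym => /negPf->.
Qed.

Let lik_num i a c :
  \sum_(x | f x == c) pmass (half_hit R [set i] a) x = (Na i a c * t%:R + N c) / 2.
Proof.
rewrite /Na /N mulr_suml -big_split/= mulr_suml; apply: eq_bigr => x _.
by rewrite pmass_half_hit1//; ring.
Qed.

Lemma lik_gt0 i a x : 0 < lik i a (f x).
Proof.
rewrite /lik divr_gt0//; last exact: N_gt0.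
rewrite lik_num divr_gt0// ltr_wpDl ?N_gt0// mulr_ge0//; exact: Na_ge0.
Qed.

Lemma lik_ge0 i a c : 0 <= lik i a c.
Proof.
by rewrite divr_ge0// sumr_ge0// => x _; rewrite ?pmass_half_hit_ge0// ltW// pmass_unif_gt0.
Qed.

Lemma sum_lik i x : \sum_a lik i a (f x) = t%:R.
Proof.
rewrite /lik -mulr_suml -/(N (f x)) (eq_bigr _ (fun a _ => lik_num i a _)).
rewrite -mulr_suml big_split/= -mulr_suml sum_Na sumr_const card_ord -[_ *+ t in X in _ + X]mulr_natl.
have := N_gt0 x; move: (N _) => y y0.
by field; rewrite gt_eqF.
Qed.

(** Unreachable values [c] contribute 0 instead of [t]. Gibbs' inequality below sums over all of
    [C], hence this form. *)
Lemma sum_lik_le i c : \sum_a lik i a c <= t%:R.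
Proof.
have [[x /eqP <-]|nx] := altP (@existsP _ (fun x => f x == c)).
  by rewrite sum_lik.
rewrite big1 ?ler0n// => a _; rewrite /lik big_pred0 ?mul0r// => x.
by apply: contraNF nx => h; apply/existsP; exists x.
Qed.

(* Convexity of [g ln g]: since the likelihoods [g] average to 1, [g ln g] has nonnegative mean, and the posterior density of [x i] is [2 g - 1]. *)
Lemma mean_neg_ln_lik_le i :
  t%:R^-1 * \sum_a E0 (fun x => - ln (lik i a (f x))) <=
  E0 (fun x => ln (lik i (x i) (f x))).
Proof.
have E0c (G : 'I_t -> C -> R) a : E0 (fun x => G a (f x)) = \sum_c N c * G a c.
  rewrite /E0 (partition_big f xpredT)//=; apply: eq_bigr => c _.
  by rewrite /N mulr_suml; apply: eq_bigr => x /eqP->.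
have -> : E0 (fun x => ln (lik i (x i) (f x))) =
    \sum_c \sum_a Na i a c * ln (lik i a c).
  rewrite /E0 (partition_big f xpredT)//=; apply: eq_bigr => c _.
  under [RHS]eq_bigr do rewrite /Na mulr_suml.
  rewrite exchange_big/=; apply: eq_bigr => x /eqP <-.
  rewrite (bigD1 (x i))//= eqxx mulr1 big1 ?addr0// => a.
  by rewrite eq_sym => /negPf->; rewrite mulr0 mul0r.
under eq_bigr do rewrite (E0c (fun a c => - ln (lik i a c))).
rewrite exchange_big/= mulr_sumr; apply: ler_sum => c _.
have [/existsP[x /eqP <-]|nx] := boolP [exists x, f x == c]; last first.
  have e G : \sum_(x : stream n t | f x == c) G x = 0 :> R.
    rewrite big_pred0// => x; by apply: contraNF nx => h; apply/existsP; exists x.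
  rewrite /N /Na e big1 ?mulr0; last by move=> a _; rewrite mul0r.
  by rewrite big1// => a _; rewrite e mul0r.
have N0 := N_gt0 x.
have NaE a : Na i a (f x) = N (f x) / t%:R * (2 * lik i a (f x) - 1).
  by rewrite /lik lik_num -/(N _); field; rewrite gt_eqF.
rewrite -subr_ge0 mulr_sumr -sumrB.
rewrite (eq_bigr (fun a => 2 * (N (f x) / t%:R) * (lik i a (f x) * ln (lik i a (f x))))).
  rewrite -mulr_sumr mulr_ge0//; first by rewrite mulr_ge0// divr_ge0// ltW.
  have : \sum_a (lik i a (f x) - 1) <= \sum_a lik i a (f x) * ln (lik i a (f x)).
    by apply: ler_sum => a _; rewrite subr1_le_mul_ln ?lik_gt0.
  by rewrite sumrB sum_lik sumr_const card_ord subrr.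
by move=> a _; rewrite NaE; field.
Qed.

(* Gibbs' inequality, where the constraint [c = f x] is dropped in the normalisation so that it costs a factor [#|C|]. *)
Lemma sum_neg_ln_lik_le :
  \sum_i t%:R^-1 * \sum_a E0 (fun x => - ln (lik i a (f x))) <= ln #|C|%:R.
Proof.
have [x0 _|nostream] := pickP (@predT (stream n t)); last first.
  have := sum_pmass_unif R n t0; rewrite big_pred0// => /esym/eqP.
  by rewrite oner_eq0.
have C0 : 0 < (#|C|%:R : R) by rewrite ltr0n; apply/card_gt0P; exists (f x0).
pose G x c := \prod_i lik i (x i) c.
have G0 x : 0 < G x (f x) by apply: prodr_gt0 => i _; exact: lik_gt0.
apply: le_trans; first by apply: ler_sum => i _; exact: mean_neg_ln_lik_le i.
rewrite exchange_big/=.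
(* This is [ln u <= u - 1] at [u = G x (f x) / #|C|]. *)
have le1 x : \sum_i pmass unif x * ln (lik i (x i) (f x)) <=
    pmass unif x * (ln #|C|%:R - 1) + pmass unif x * G x (f x) / #|C|%:R.
  rewrite -mulr_sumr -mulrA -mulrDr ler_wpM2l//; first by rewrite ltW// pmass_unif_gt0.
  rewrite -ln_prod; last by move=> i; exact: lik_gt0.
  have := @ln_le_subr1 _ (G x (f x) / #|C|%:R).
  by rewrite divr_gt0// ln_div ?posrE// /G => /(_ isT); lra.
apply: le_trans; first by apply: ler_sum => x _; exact: le1 x.
rewrite big_split/= -!mulr_suml sum_pmass_unif// mul1r.
suff : (\sum_x pmass unif x * G x (f x)) / #|C|%:R <= 1 by lra.
rewrite ler_pdivrMr// mul1r.
apply: (@le_trans _ _ (\sum_c \sum_x pmass unif x * G x c)).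
  rewrite exchange_big/=; apply: ler_sum => x _.
  rewrite [leRHS](bigD1 (f x))//= lerDl sumr_ge0// => c _.
  by rewrite mulr_ge0 ?(ltW (pmass_unif_gt0 _ _ _))// prodr_ge0// => i _; exact: lik_ge0.
have le2 c : \sum_x pmass unif x * G x c <= 1.
  under eq_bigr do rewrite -big_split/=.
  rewrite -(bigA_distr_bigA (fun i a => t%:R^-1 * lik i a c)) -[leRHS](expr1n _ n).
  rewrite -[X in _ ^+ X]card_ord -prodr_const; apply: ler_prod => i _.
  rewrite -mulr_sumr; apply/andP; split.
    by rewrite mulr_ge0 ?invr_ge0// sumr_ge0// => a _; exact: lik_ge0.
  by rewrite mulrC ler_pdivrMr ?ltr0n// mul1r sum_lik_le.
apply: le_trans; first by apply: ler_sum => c _; exact: le2 c.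
by rewrite sumr_const.
Qed.

(** Since [- ln u >= 1 - u] and the likelihoods average to 1 over needles. The sign is what permits
    overcounting pairs of cuts later. *)
Lemma mean_neg_ln_lik_ge0 i :
  0 <= t%:R^-1 * \sum_a E0 (fun x => - ln (lik i a (f x))).
Proof.
rewrite mulr_ge0 ?invr_ge0// /E0 exchange_big sumr_ge0// => x _ /=.
rewrite -mulr_sumr mulr_ge0//; first by rewrite ltW// pmass_unif_gt0.
have : \sum_a (1 - lik i a (f x)) <= \sum_a - ln (lik i a (f x)).
  apply: ler_sum => a _; have := ln_le_subr1 (lik_gt0 i a x); lra.
by rewrite sumrB sum_lik sumr_const card_ord subrr.
Qed.

End Gibbs.

(** * Exchanging segments between streams *)

Definition splice (n t : nat) (a b : nat) (x y : stream n t) : stream n t :=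
  [ffun i : 'I_n => if (a <= i < b)%N then y i else x i].

Lemma spliceK n t a b (x y : stream n t) :
  splice a b (splice a b x y) (splice a b y x) = x.
Proof. by apply/ffunP => i; rewrite !ffunE; case: (_ <= _ < _)%N. Qed.

Section Swap.
Variables (R : realType) (n t : nat).
Implicit Types (x y : stream n t).

Lemma sum_splice a b (F : stream n t -> stream n t -> R) :
  \sum_x \sum_y F x y = \sum_x \sum_y F (splice a b x y) (splice a b y x).
Proof.
rewrite !pair_bigA/=.
rewrite (reindex_inj (h := fun z => (splice a b z.1 z.2, splice a b z.2 z.1)))//.
move=> [x y] [x' y'] [h1 h2].
by congr (_, _); [rewrite -(spliceK a b x y)|rewrite -(spliceK a b y x)];
  rewrite h1 h2 spliceK.
Qed.

(* Swapping the segment [a, b) between a stream in which [i] may be a hit and an independent uniform stream moves the hit at [i] to the latter. *)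
Lemma pmass_splice (H : {set 'I_n}) (i : 'I_n) (alpha : 'I_t) a b x y :
  (a <= i < b)%N -> i \notin H -> (forall j, j \in H -> ~~ (a <= j < b)%N) ->
  pmass (half_hit R (i |: H) alpha) (splice a b x y) * pmass (@unif R n t) (splice a b y x) =
  pmass (half_hit R H alpha) x * pmass (half_hit R [set i] alpha) y.
Proof.
move=> iab iH Hab; rewrite /pmass -!big_split/=; apply: eq_bigr => j _.
rewrite !ffunE /half_hit !inE /unif; case jab: (a <= j < b)%N.
  have /negPf-> : j \notin H by apply: contraTN jab => /Hab.
  by rewrite orbF mulrC.
have /negPf-> : j != i by apply: contraFN jab => /eqP->.
by [].
Qed.

(** Pair [x] with an independent uniform [y] conditioned on [f y = f x]. Swapping the segments keeps
    this condition and [Phi], and moves the hit at [i] from [x] to [y]; summing over [y] then yields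
    the likelihood ratio. *)
Lemma half_hit_lik (C : finType) (f : stream n t -> C) (Phi : stream n t -> R)
    (H : {set 'I_n}) (i : 'I_n) (alpha : 'I_t) a b :
  (0 < t)%N ->
  (a <= i < b)%N -> i \notin H -> (forall j, j \in H -> ~~ (a <= j < b)%N) ->
  (forall x y, f x = f y -> f (splice a b x y) = f x) ->
  (forall x y, f x = f y -> Phi (splice a b x y) = Phi x) ->
  \sum_x pmass (half_hit R (i |: H) alpha) x * Phi x =
  \sum_x pmass (half_hit R H alpha) x * (Phi x * lik R f i alpha (f x)).
Proof.
move=> t0 iab iH Hab fs Phis.
pose N c := \sum_(y | f y == c) pmass (@unif R n t) y.
have N0 x : N (f x) != 0.
  rewrite gt_eqF// /N (bigD1 x)//= ltr_wpDr ?pmass_unif_gt0// sumr_ge0// => y _.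
  by rewrite ltW// pmass_unif_gt0.
transitivity (\sum_x \sum_y pmass (half_hit R (i |: H) alpha) x * pmass (@unif R n t) y *
   ((f y == f x)%:R * Phi x / N (f x))).
  apply: eq_bigr => x _.
  transitivity (pmass (half_hit R (i |: H) alpha) x * Phi x / N (f x) * N (f x)).
    by rewrite divfK.
  rewrite {2}/N mulr_sumr big_mkcond/=; apply: eq_bigr => y _.
  by case: (f y == f x); rewrite ?mul0r ?mulr0// mul1r; ring.
rewrite (sum_splice a b); apply: eq_bigr => x _.
rewrite /lik !mulr_suml !mulr_sumr [RHS]big_mkcond/=; apply: eq_bigr => y _.
rewrite pmass_splice//.
(* Swapping twice is the identity, so closure of the fibres of [f] under splicing gives both
   directions. *)
have -> : (f (splice a b y x) == f (splice a b x y)) = (f y == f x).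
  apply/eqP/eqP => h; last by rewrite (fs y x)// (fs x y).
  have fy := fs _ _ h; have fx := fs _ _ (esym h).
  by rewrite spliceK in fy; rewrite spliceK in fx; rewrite fy fx.
by case: eqP => [fyx|]; rewrite ?mul0r ?mulr0// fs// Phis// mul1r -/(N _); ring.
Qed.

(* [- ln u >= 1 - u] is used with [u = g / 2] where [out] accepts and with [u = g] where it rejects. *)
Lemma half_sub_err_le (out : pred (stream n t)) (g nu : stream n t -> R) :
  (forall x, 0 < g x) ->
  \sum_x pmass (@unif R n t) x = 1 -> (0 < t)%N ->
  \sum_x nu x = 1 -> (forall x, 0 <= nu x) ->
  (forall b, \sum_(x | out x == b) nu x = \sum_(x | out x == b) pmass unif x * g x) ->
  2^-1 - \sum_(x | out x == true) pmass unif x - \sum_(x | out x == false) nu x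
    <= \sum_x pmass unif x * (- ln (g x)).
Proof.
move=> g0 s1 t0 snu nu0 eq_nu.
have split_out (F : stream n t -> R) :
    \sum_x F x = \sum_(x | out x == true) F x + \sum_(x | out x == false) F x.
  rewrite (bigID out)/=; congr (_ + _); apply: eq_bigl => x; by case: (out x).
have u0 x : 0 <= pmass (@unif R n t) x by rewrite ltW// pmass_unif_gt0.
have hT : - (\sum_(x | out x == true) nu x) / 2 <=
    \sum_(x | out x == true) pmass unif x * (- ln (g x)).
  rewrite eq_nu mulNr mulr_suml -sumrN; apply: ler_sum => x _.
  rewrite -mulrA -mulrN ler_wpM2l// lerN2.
  have := @ln_le_subr1 _ (g x / 2); rewrite divr_gt0// => /(_ isT).
  have := @ln_le_subr1 R 2; rewrite ltr0n => /(_ isT).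
  rewrite ln_div ?posrE//; lra.
have hF : \sum_(x | out x == false) pmass unif x - \sum_(x | out x == false) nu x <=
    \sum_(x | out x == false) pmass unif x * (- ln (g x)).
  rewrite eq_nu -sumrB; apply: ler_sum => x _.
  rewrite -[X in X - _]mulr1 -mulrBr ler_wpM2l//.
  have := ln_le_subr1 (g0 x); lra.
move: (split_out (fun x => pmass unif x * (- ln (g x)))) s1 snu.
rewrite (split_out (pmass unif)) (split_out nu).
have : 0 <= \sum_(x | out x == false) nu x by rewrite sumr_ge0.
lra.
Qed.

End Swap.

(** * Segments of the stream around the hits *)

Lemma bigmax_attained (I : finType) (P : pred I) (F : I -> nat) :
  \max_(i | P i) F i = 0%N \/ exists2 i, P i & \max_(i | P i) F i = F i.
Proof.
elim/big_ind: _ => [|m1 m2 IH1 IH2|i Pi]; [by left| |by right; exists i].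
by case: (leqP m1 m2).
Qed.

Lemma sum1_ord_interval (n a b : nat) :
  (\sum_(j < n | a <= j < b) 1 = minn n b - a)%N.
Proof.
elim: n => [|n IH]; first by rewrite big_ord0 min0n.
rewrite big_mkcond big_ord_recr/= -big_mkcond/= IH; case: ifP; lia.
Qed.

Section Segments.
Variable n : nat.
Implicit Types (H : {set 'I_n}) (i j : 'I_n).

(* One plus the predecessor of [i] in [H], or 0 if there is none. *)
Definition prev_hit H i := (\max_(j in H | (j < i)%N) j.+1)%N.

(* [n] minus the successor of [i] in [H], or 0 if there is none. *)
Definition next_hit H i := (\max_(j in H | (i < j)%N) (n - j))%N.

(* The segment of [i] is [lo, hi), cut at the midpoints to its neighbours in [H]. *)
Definition lo H i := (if prev_hit H i == 0 then 0 else (prev_hit H i + i)./2)%N.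
Definition hi H i := (if next_hit H i == 0 then n else (i + (n - next_hit H i)).+1./2)%N.

(** The roundings make consecutive hits [i < k] share a cut: [(i + k).+1./2] is both the upper end
    for [i] and the lower end for [k]. *)
Variant lo_spec H i : nat -> Prop :=
| LoNone : (forall j, j \in H -> (i <= j)%N) -> lo_spec H i 0
| LoSome k : k \in H -> (k < i)%N ->
    (forall j, j \in H -> (j < i)%N -> (j <= k)%N) -> lo_spec H i (k.+1 + i)./2.

Variant hi_spec H i : nat -> Prop :=
| HiNone : (forall j, j \in H -> (j <= i)%N) -> hi_spec H i n
| HiSome k : k \in H -> (i < k)%N ->
    (forall j, j \in H -> (i < j)%N -> (k <= j)%N) -> hi_spec H i (i + k).+1./2.

Lemma loP H i : lo_spec H i (lo H i).
Proof.
rewrite /lo; have le j : j \in H -> (j < i)%N -> (j < prev_hit H i)%N.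
  move=> jH ji; rewrite /prev_hit.
  by apply: (@leq_bigmax_cond _ _ (fun j : 'I_n => j.+1)); rewrite jH.
have [p0|[k /andP[kH ki] pk]] := bigmax_attained (fun j => (j \in H) && (j < i)%N) (fun j => j.+1).
  rewrite -/(prev_hit H i) in p0; rewrite p0 eqxx; constructor => j jH.
  by rewrite leqNgt; apply/negP => /(le _ jH); rewrite p0.
rewrite -/(prev_hit H i) in pk; rewrite pk; constructor => // j jH ji.
by have := le _ jH ji; rewrite pk.
Qed.

Lemma hiP H i : hi_spec H i (hi H i).
Proof.
rewrite /hi; have le j : j \in H -> (i < j)%N -> (n - j <= next_hit H i)%N.
  move=> jH ji; rewrite /next_hit.
  by apply: (@leq_bigmax_cond _ _ (fun j : 'I_n => n - j)%N); rewrite jH.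
have [p0|[k /andP[kH ki] pk]] := bigmax_attained (fun j => (j \in H) && (i < j)%N) (fun j => n - j)%N.
  rewrite -/(next_hit H i) in p0; rewrite p0 eqxx; constructor => j jH.
  by rewrite leqNgt; apply/negP => /(le _ jH); rewrite p0; have := ltn_ord j; lia.
rewrite -/(next_hit H i) in pk; rewrite pk; have kn := ltn_ord k.
have -> : (n - k == 0)%N = false by lia.
have -> : (n - (n - k) = k)%N by lia.
constructor => // j jH ji.
by have := le _ jH ji; rewrite pk; have := ltn_ord j; lia.
Qed.

Lemma lo_le H i : (lo H i <= i)%N.
Proof. by case: loP => // k _ ki _; lia. Qed.

Lemma hi_gt H i : (i < hi H i)%N.
Proof. by case: hiP => // k _ ki _; lia. Qed.

Lemma hi_le H i : (hi H i <= n)%N.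
Proof. by case: hiP => // k _ ki _; have := ltn_ord k; lia. Qed.

Lemma hi_le_lo H i j : i \in H -> j \in H -> (i < j)%N -> (hi H i <= lo H j)%N.
Proof.
move=> iH jH ij; case: hiP => [/(_ _ jH)|k kH ki /(_ _ jH ij) kj]; first by lia.
by case: loP => [/(_ _ iH)|l lH lj /(_ _ iH ij) il]; lia.
Qed.

End Segments.

(** * Random hit sets and the distribution of the cuts *)

Section HitMeasure.
Variables (R : realType) (n : nat) (q : R).
Hypotheses (q0 : 0 <= q) (q1 : q <= 1).
Implicit Types (H : {set 'I_n}).

Definition hit_mass H : R := \prod_(i < n) (if i \in H then q else 1 - q).

Lemma hit_mass_ge0 H : 0 <= hit_mass H.
Proof. by apply: prodr_ge0 => i _; case: ifP => _ //; rewrite subr_ge0. Qed.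

Lemma sum_hit_mass : \sum_H hit_mass H = 1.
Proof.
rewrite -(bigA_distr _ _ (fun=> q) (fun=> 1 - q)).
by rewrite big1// => i _ /=; ring.
Qed.

(** Positions are hits independently, so a conjunction of conditions on single positions has product
    probability. *)
Lemma sum_hit_mass_prod (phi : 'I_n -> bool -> bool) :
  \sum_H hit_mass H * \prod_j (phi j (j \in H))%:R =
  \prod_j (q * (phi j true)%:R + (1 - q) * (phi j false)%:R).
Proof.
rewrite bigA_distr; apply: eq_bigr => H _; rewrite -big_split/=.
by apply: eq_bigr => j _; case: (j \in H).
Qed.

Lemma geometric_sum_le1 (a : nat) :
  \sum_(b < n | (a <= b)%N) q * (1 - q) ^+ (b - a) <= 1.
Proof.
suff -> : \sum_(b < n | (a <= b)%N) q * (1 - q) ^+ (b - a) = 1 - (1 - q) ^+ (n - a).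
  by rewrite lerBlDr lerDl exprn_ge0// subr_ge0.
elim: n => [|m IH]; first by rewrite big_ord0 sub0n expr0 subrr.
rewrite big_mkcond big_ord_recr/= -big_mkcond/= IH; case: leqP => am.
  by rewrite subSn// exprS; ring.
have -> : (m - a = 0)%N by lia.
have -> : (m.+1 - a = 0)%N by lia.
by rewrite addr0.
Qed.

Lemma geometric_sum_rev_le1 (b : 'I_n) :
  \sum_(a < n | (a <= b)%N) q * (1 - q) ^+ (b - a) <= 1.
Proof.
rewrite (reindex_inj rev_ord_inj)/=; apply: le_trans (geometric_sum_le1 (rev_ord b)).
have bn := ltn_ord b; rewrite (eq_bigl (fun a : 'I_n => rev_ord b <= a)%N); last first.
  by move=> a /=; have := ltn_ord a; lia.
apply: ler_sum => a /= ba; suff -> : (b - (n - a.+1) = a - (n - b.+1))%N by [].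
by have := ltn_ord a; lia.
Qed.

Lemma sum_eq_le1 (m : nat) : \sum_(a < n) (a == m :> nat)%:R <= 1 :> R.
Proof.
rewrite (eq_bigr (fun a : 'I_n => if a == m :> nat then 1 else 0)); last first.
  by move=> a _; case: eqP.
by rewrite -big_mkcond/= (big_ord1_eq _ (fun=> 1)); case: ifP.
Qed.

(* The events [lo H i = a] and [hi H i = b] force at most two possible positions for the neighbouring hits of [i]; [None] stands for a missing neighbour. *)
Let preds (i : 'I_n) (a : nat) := [:: None; Some (2 * a - i - 1)%N; Some (2 * a - i)%N].
Let okl (a : nat) (o : option nat) := if o is Some m then (m < a)%N else (a == 0)%N.
Let okr (b : nat) (o : option nat) := if o is Some m then (b <= m < n)%N else (b == n)%N.

(** Position-wise conditions: [i] is a hit, the rest of [[a, b)] is free of hits, and the named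
    neighbours are hits. Their conjunction is implied by the cuts being [a] and [b] with these
    neighbours, and it factors over positions. *)
Let phi (i : 'I_n) (a b : nat) (o o' : option nat) (j : 'I_n) (e : bool) : bool :=
  [&& (if j == i then e else if (a <= j < b)%N then ~~ e else true),
    (o == Some (val j)) ==> e & (o' == Some (val j)) ==> e].

Let wt (o : option nat) : R := if o is Some _ then q else 1.

Let prod_wt (o : option nat) : (if o is Some m then m < n else true)%N ->
  \prod_(j < n) (if o == Some (val j) then q else 1) = wt o.
Proof.
case: o => [m mn|_]; last by rewrite big1.
rewrite (bigD1 (Ordinal mn))//= eqxx big1 ?mulr1// => j; rewrite -val_eqE/= => jm.
by case: eqP => // -[mj]; rewrite mj eqxx in jm.
Qed.

(** The exponent counts the positions of [[a, b)] other than [i]. By [okl] and [okr] the neighbours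
    lie on opposite sides of [[a, b)], so all constraints concern distinct positions. *)
Let sum_phi (i : 'I_n) a b o o' : (a <= i < b)%N -> (b <= n)%N -> okl a o -> okr b o' ->
  \sum_H hit_mass H * \prod_j (phi i a b o o' j (j \in H))%:R =
  q * (1 - q) ^+ (b.-1 - a) * wt o * wt o'.
Proof.
move=> iab bn ol or; rewrite sum_hit_mass_prod.
rewrite -(@prod_wt o); last by case: o ol => //= m ma; have := ltn_ord i; lia.
rewrite -(@prod_wt o'); last by case: o' or => //= m; lia.
have -> : q * (1 - q) ^+ (b.-1 - a) =
    \prod_(j < n) (if j == i then q else if (a <= j < b)%N then 1 - q else 1).
  rewrite (bigD1 i)//= eqxx; congr (_ * _).
  rewrite (eq_bigr (fun j : 'I_n => if (a <= j < b)%N then 1 - q else 1)); last first.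
    by move=> j /negPf->.
  rewrite -big_mkcondr/= prodr_const; congr (_ ^+ _).
  have := cardD1 i [pred j : 'I_n | (a <= j < b)%N]; rewrite inE iab.
  have -> : #|[pred j : 'I_n | (a <= j < b)%N]| = (b - a)%N.
    rewrite -sum1_card (eq_bigl (fun j : 'I_n => a <= j < b)%N)//.
    by rewrite sum1_ord_interval; lia.
  have -> : #|[predD1 [pred j : 'I_n | (a <= j < b)%N] & i]| =
    #|(fun j : 'I_n => (j != i) && (a <= j < b)%N)| by apply: eq_card => j; rewrite !inE.
  by move=> h; lia.
rewrite -!big_split/=; apply: eq_bigr => j _; rewrite /phi.
have [->|ji] := eqVneq j i.
  have -> : (o == Some (val i)) = false.
    by case: o ol => //= m ma; apply/eqP => -[mi]; lia.
  have -> : (o' == Some (val i)) = false.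
    by case: o' or => //= m ma; apply/eqP => -[mi]; lia.
  by rewrite /=; ring.
case: ifP => jab /=.
  have -> : (o == Some (val j)) = false.
    by case: o ol => //= m ma; apply/eqP => -[mi]; lia.
  have -> : (o' == Some (val j)) = false.
    by case: o' or => //= m ma; apply/eqP => -[mi]; lia.
  by rewrite /=; ring.
case: eqP => oj; case: eqP => oj' /=; try by ring.
by subst o o'; move: ol or => /=; lia.
Qed.

(** A missing neighbour has weight 1 but is possible only at the end of the stream; each of the two
    candidate positions has weight [q]. *)
Let sum_wt_l (i : 'I_n) a : \sum_(o <- preds i a | okl a o) wt o <= (a == 0)%:R + 2 * q.
Proof.
rewrite !big_cons big_nil /=; case: eqP => _; do 2 case: ifP => _; rewrite /wt /=; move: q0; lra.
Qed.

Let sum_wt_r (i : 'I_n) b : \sum_(o <- preds i b | okr b o) wt o <= (b == n)%:R + 2 * q.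
Proof.
rewrite !big_cons big_nil /=; case: eqP => _; do 2 case: ifP => _; rewrite /wt /=; move: q0; lra.
Qed.

Let lo_witness H (i : 'I_n) : exists2 o, (o \in preds i (lo H i)) && okl (lo H i) o &
   forall m, o = Some m -> exists2 k : 'I_n, k \in H & m = k.
Proof.
case: loP => [_|k kH ki _]; first by exists None.
exists (Some (val k)); last by move=> m [<-]; exists k.
rewrite /okl !inE /=; apply/andP; split; last by lia.
by have [e|e] : (val k = 2 * (k.+1 + i)./2 - i - 1 \/ val k = 2 * (k.+1 + i)./2 - i)%N
  by [rewrite /=; lia]; rewrite -e eqxx ?orbT.
Qed.

Let hi_witness H (i : 'I_n) : exists2 o, (o \in preds i (hi H i)) && okr (hi H i) o &
   forall m, o = Some m -> exists2 k : 'I_n, k \in H & m = k.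
Proof.
case: hiP => [_|k kH ki _]; first by exists None; rewrite //= eqxx.
exists (Some (val k)); last by move=> m [<-]; exists k.
rewrite /okr !inE /=; apply/andP; split; last by have := ltn_ord k; lia.
by have [e|e] : (val k = 2 * (i + k).+1./2 - i - 1 \/ val k = 2 * (i + k).+1./2 - i)%N
  by [rewrite /=; lia]; rewrite -e eqxx ?orbT.
Qed.

Let phi_lo_hi H (i : 'I_n) (o o' : option nat) : i \in H ->
  (forall m, o = Some m -> exists2 k : 'I_n, k \in H & m = k) ->
  (forall m, o' = Some m -> exists2 k : 'I_n, k \in H & m = k) ->
  forall j, phi i (lo H i) (hi H i) o o' j (j \in H).
Proof.
move=> iH oH oH' j; apply/and3P; split.
- have [->//|ji] := eqVneq; case: ifP => // jab; apply/negP => jH.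
  have : (i < j)%N || (j < i)%N by rewrite -neq_ltn eq_sym.
  case/orP => h.
    by have := hi_le_lo iH jH h; have := lo_le H j; lia.
  by have := hi_le_lo jH iH h; have := hi_gt H j; lia.
- by apply/implyP => /eqP /oH[k kH /val_inj->].
- by apply/implyP => /eqP /oH'[k kH /val_inj->].
Qed.

(** A union bound over candidate neighbours replaces the random cuts by fixed ones. The resulting
    weight of [(a, b)] is independent of [i], so [J] can be summed over [i] first, at cost [B]. *)
Lemma sum_lo_hi_le (J : 'I_n -> nat -> nat -> R) (B : R) :
  (forall i a b, 0 <= J i a b) -> (forall a b, \sum_i J i a b <= B) -> 0 <= B ->
  \sum_H hit_mass H * \sum_(i in H) J i (lo H i) (hi H i)
    <= B * (5 * q + 4 * q ^+ 2 * n%:R).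
Proof.
move=> J0 JB B0.
(* The number of candidate pairs compatible with [H]; it is at least 1 at the true cuts. *)
pose ind H i a b : R := \sum_(o <- preds i a | okl a o) \sum_(o' <- preds i b | okr b o')
   \prod_j (phi i a b o o' j (j \in H))%:R.
have ind_ge0 H i a b : 0 <= ind H i a b.
  by do 2 apply: sumr_ge0 => ? _; apply: prodr_ge0 => j _; exact: ler0n.
have ind_ge1 H i : i \in H -> 1 <= ind H i (lo H i) (hi H i).
  move=> iH; have [o /andP[os ok] oH] := lo_witness H i.
  have [o' /andP[os' ok'] oH'] := hi_witness H i.
  rewrite /ind (big_rem o)//= ok (big_rem o')//= ok'.
  rewrite big1 => [|j _]; last by rewrite phi_lo_hi.
  rewrite -addrA lerDl addr_ge0//.
    by apply: sumr_ge0 => ? _; apply: prodr_ge0 => ? _; exact: ler0n.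
  by do 2 apply: sumr_ge0 => ? _; apply: prodr_ge0 => ? _; exact: ler0n.
pose W (a b : nat) : R := ((a == 0)%:R + 2 * q) * ((b == n)%:R + 2 * q).
have W0 a b : 0 <= W a b by rewrite mulr_ge0// addr_ge0// mulr_ge0.
(* Upper cuts lie between 1 and [n], so they are written [b.+1] with [b < n]. *)
apply: (@le_trans _ _ (\sum_(H : {set 'I_n}) \sum_(i in H) \sum_(a < n) \sum_(b < n | (a <= i <= b)%N)
    J i a b.+1 * (hit_mass H * ind H i a b.+1))).
  apply: ler_sum => H _; rewrite mulr_sumr; apply: ler_sum => i iH.
  have lon : (lo H i < n)%N by have := lo_le H i; have := ltn_ord i; lia.
  have hin : ((hi H i).-1 < n)%N by have := hi_gt H i; have := hi_le H i; lia.
  have hiE : (hi H i).-1.+1 = hi H i by have := hi_gt H i; lia.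
  rewrite (bigD1 (Ordinal lon))//= (bigD1 (Ordinal hin))/=; last first.
    by have := hi_gt H i; have := lo_le H i; lia.
  rewrite hiE -addrA mulrC ler_wpDr//.
    by rewrite addr_ge0//; do ?[apply: sumr_ge0 => ? _];
      rewrite mulr_ge0// mulr_ge0// hit_mass_ge0.
  by rewrite ler_wpM2l// ler_peMr ?hit_mass_ge0// ind_ge1.
(* Averaging over [H] turns [ind] into probabilities given by [sum_phi], which [W] bounds after
   summation over the candidates. *)
apply: (@le_trans _ _ (\sum_(a < n) \sum_(b < n | (a <= b)%N) \sum_(i < n)
    J i a b.+1 * (q * (1 - q) ^+ (b - a) * W a b.+1))).
  apply: (@le_trans _ _ (\sum_(H : {set 'I_n}) \sum_(i < n) \sum_(a < n) \sum_(b < n | (a <= i <= b)%N)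
      J i a b.+1 * (hit_mass H * ind H i a b.+1))).
    apply: ler_sum => H _; rewrite [leRHS](bigID (mem H))/= lerDl.
    by do 3 apply: sumr_ge0 => ? _; rewrite mulr_ge0// mulr_ge0// hit_mass_ge0.
  rewrite exchange_big/=; under eq_bigr => i _ do rewrite exchange_big/=.
  rewrite exchange_big/=; apply: ler_sum => a _.
  rewrite [leRHS]exchange_big/=; apply: ler_sum => i _.
  rewrite exchange_big/= big_mkcond [leRHS]big_mkcond/=; apply: ler_sum => b _.
  case: ifP => [/andP[ai ib]|_]; last first.
    case: ifP => // _; rewrite mulr_ge0// mulr_ge0// mulr_ge0// exprn_ge0// subr_ge0//.
  rewrite (leq_trans ai ib) -mulr_sumr ler_wpM2l//.
  under eq_bigr do rewrite mulr_sumr.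
  rewrite exchange_big/=; under eq_bigr => o _ do under eq_bigr => H _ do rewrite mulr_sumr.
  under eq_bigr => o _ do rewrite exchange_big/=.
  rewrite (eq_bigr (fun o => q * (1 - q) ^+ (b - a) * wt o *
      \sum_(o' <- preds i b.+1 | okr b.+1 o') wt o')) => [|o ol]; last first.
    rewrite mulr_sumr; apply: eq_bigr => o' or; rewrite sum_phi//; lia.
  rewrite -mulr_suml -mulr_sumr -mulrA ler_wpM2l//.
    by rewrite mulr_ge0// exprn_ge0// subr_ge0.
  by apply: ler_pM => //; apply: sumr_ge0 => -[].
pose G (a b : nat) : R := q * (1 - q) ^+ (b - a).
have G0 a b : 0 <= G a b by rewrite mulr_ge0// exprn_ge0// subr_ge0.
apply: (@le_trans _ _ (B * \sum_(a < n) \sum_(b < n | (a <= b)%N) G a b * W a b.+1)).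
  rewrite mulr_sumr; apply: ler_sum => a _; rewrite mulr_sumr; apply: ler_sum => b ab.
  by rewrite -mulr_suml ler_wpM2r ?JB//; exact: mulr_ge0 (G0 a b) (W0 _ _).
rewrite ler_wpM2l//.
(* Expanding [W] gives four sums: both neighbours missing costs at most [q], exactly one missing
   costs [2 * q] on each side by a geometric series, and none missing costs [4 * q ^+ 2 * n]. *)
have le1 : \sum_(a < n) \sum_(b < n | (a <= b)%N) G a b * ((a == 0 :> nat)%:R * (b.+1 == n)%:R) <= q.
  apply: (@le_trans _ _ (\sum_(a < n) \sum_(b < n | (a <= b)%N)
      q * ((a == 0 :> nat)%:R * (b == n.-1 :> nat)%:R))).
    apply: ler_sum => a _; apply: ler_sum => b ab.
    have -> : (b.+1 == n) = (b == n.-1 :> nat) by have := ltn_ord b; lia.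
    rewrite ler_wpM2r ?mulr_ge0// /G ler_piMr// exprn_ile1//; first by rewrite subr_ge0.
    by rewrite lerBlDr lerDl.
  under eq_bigr do rewrite -!mulr_sumr.
  rewrite -mulr_sumr ler_piMr//; apply: le_trans (sum_eq_le1 0).
  apply: ler_sum => a _; rewrite ler_piMr//; apply: le_trans (sum_eq_le1 n.-1).
  rewrite [leRHS](bigID (fun b : 'I_n => a <= b)%N)/= lerDl sumr_ge0//.
have le2 : \sum_(a < n) \sum_(b < n | (a <= b)%N) G a b * (a == 0 :> nat)%:R <= 1.
  apply: le_trans (sum_eq_le1 0); apply: ler_sum => a _.
  by rewrite -mulr_suml ler_piMl// geometric_sum_le1.
have le3 : \sum_(a < n) \sum_(b < n | (a <= b)%N) G a b * (b.+1 == n)%:R <= 1.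
  rewrite (exchange_big_dep xpredT)//=; apply: le_trans (sum_eq_le1 n.-1); apply: ler_sum => b _.
  have -> : (b.+1 == n) = (b == n.-1 :> nat) by have := ltn_ord b; lia.
  by rewrite -mulr_suml ler_piMl// geometric_sum_rev_le1.
have le4 : \sum_(a < n) \sum_(b < n | (a <= b)%N) G a b <= n%:R.
  rewrite -[n in leRHS]card_ord -sumr_const; apply: ler_sum => a _.
  exact: geometric_sum_le1.
have -> : \sum_(a < n) \sum_(b < n | (a <= b)%N) G a b * W a b.+1 =
  \sum_(a < n) \sum_(b < n | (a <= b)%N) G a b * ((a == 0 :> nat)%:R * (b.+1 == n)%:R) +
  2 * q * \sum_(a < n) \sum_(b < n | (a <= b)%N) G a b * (a == 0 :> nat)%:R +
  2 * q * \sum_(a < n) \sum_(b < n | (a <= b)%N) G a b * (b.+1 == n)%:R +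
  4 * q ^+ 2 * \sum_(a < n) \sum_(b < n | (a <= b)%N) G a b.
  rewrite !mulr_sumr -!big_split/=; apply: eq_bigr => a _.
  rewrite !mulr_sumr -!big_split/=; apply: eq_bigr => b _.
  by rewrite /W; ring.
have q2 : 0 <= 2 * q by rewrite mulr_ge0.
have := ler_wpM2l q2 le2; have := ler_wpM2l q2 le3.
have : 0 <= 4 * q ^+ 2 by rewrite mulr_ge0// exprn_ge0.
move=> /ler_wpM2l /(_ _ _ le4); lra.
Qed.

End HitMeasure.

(** * The error bound for an abstract record with the splicing property *)

Section Transcript.
Variables (R : realType) (n t : nat) (S : finType).
Variables (V : nat -> stream n t -> S) (out : pred (stream n t)).
Implicit Types (x y : stream n t) (H : {set 'I_n}).
Hypothesis t0 : (0 < t)%N.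

Definition ends a b x := (V a x, V b x).

Hypothesis V_splice : forall a b x y l, (a <= b <= n)%N -> ends a b x = ends a b y ->
  (l <= a)%N || (b <= l)%N -> V l (splice a b x y) = V l x.
Hypothesis out_splice : forall a b x y, (a <= b <= n)%N -> ends a b x = ends a b y ->
  out (splice a b x y) = out x.

Lemma segment_bounds H i : (lo H i <= i < hi H i)%N && (hi H i <= n)%N.
Proof. by rewrite lo_le hi_gt hi_le. Qed.

Lemma segment_disjoint H i j : i \in H -> j \in H -> i != j ->
  (hi H j <= lo H i)%N || (hi H i <= lo H j)%N.
Proof.
move=> iH jH; rewrite -val_eqE neq_ltn => /orP[|] ij.
  by rewrite (hi_le_lo iH jH ij) orbT.
by rewrite (hi_le_lo jH iH ij).
Qed.

Definition needle_lik H alpha x : R :=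
  \prod_(i in H) lik R (ends (lo H i) (hi H i)) i alpha (ends (lo H i) (hi H i) x).

Lemma needle_lik_gt0 H alpha x : 0 < needle_lik H alpha x.
Proof. by apply: prodr_gt0 => i _; exact: lik_gt0. Qed.

(** Hits are removed one at a time by [half_hit_lik]. The segments are disjoint, so a swap in one of
    them changes neither the output nor the factors of the others. *)
Lemma pmass_half_hit_lik H alpha b :
  \sum_(x | out x == b) pmass (half_hit R H alpha) x =
  \sum_(x | out x == b) pmass unif x * needle_lik H alpha x.
Proof.
pose L i x := lik R (ends (lo H i) (hi H i)) i alpha (ends (lo H i) (hi H i) x).
(* [A] holds the hits still present in the measure, and those of [H :\: A] have become factors. The
   cuts remain those of the full [H]. *)
suff step m (A : {set 'I_n}) : #|A| = m -> A \subset H ->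
    \sum_x pmass (half_hit R A alpha) x * ((out x == b)%:R * \prod_(i in H :\: A) L i x) =
    \sum_x pmass unif x * ((out x == b)%:R * \prod_(i in H) L i x).
  transitivity (\sum_x pmass (half_hit R H alpha) x *
      ((out x == b)%:R * \prod_(i in H :\: H) L i x)).
    rewrite big_mkcond; apply: eq_bigr => x _; rewrite setDv big_set0.
    by case: eqP; rewrite ?mulr1 ?mul0r ?mulr0.
  rewrite (step _ _ erefl (subxx _)) [RHS]big_mkcond; apply: eq_bigr => x _.
  by case: eqP; rewrite ?mul1r ?mul0r ?mulr0.
elim: m A => [|m IH] A Am AH.
  have -> : A = set0 by apply/eqP; rewrite -cards_eq0 Am.
  by apply: eq_bigr => x _; rewrite pmass_half_hit0 setD0.
have [i iA] : exists i, i \in A by apply/card_gt0P; rewrite Am.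
have iH := subsetP AH _ iA; have /andP[iab bn] := segment_bounds H i.
have AE : i |: (A :\ i) = A by rewrite setD1K.
have le_lohi : (lo H i <= hi H i <= n)%N by lia.
rewrite -(IH (A :\ i)); first last.
- exact: subset_trans (subsetDl _ _) AH.
- by have := cardsD1 i A; rewrite iA Am => -[].
rewrite -{1}AE (@half_hit_lik R n t _ (ends (lo H i) (hi H i)) _ _ _ _ (lo H i) (hi H i))//.
- apply: eq_bigr => x _; rewrite -mulrA; congr (_ * (_ * _)).
  have -> : H :\: (A :\ i) = i |: (H :\: A).
    apply/setP => j; rewrite !inE negb_and negbK; case: eqVneq => //= ->.
    by rewrite iH.
  by rewrite big_setU1 ?inE ?iA//= mulrC.
- by rewrite !inE eqxx.
- move=> j; rewrite !inE => /andP[ji jA].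
  have := segment_disjoint iH (subsetP AH _ jA); rewrite eq_sym ji => /(_ isT).
  by have /andP[] := segment_bounds H j; lia.
- move=> x y xy; rewrite /ends !V_splice//; lia.
move=> x y xy; rewrite (out_splice _ xy)//; congr (_ * _).
apply: eq_bigr => j; rewrite !inE => /andP[jA jH].
have ij : i != j by apply: contraNneq jA => <-.
have := segment_disjoint iH jH ij; have /andP[] := segment_bounds H j.
by move=> jab jn h; rewrite /L /ends !V_splice//; lia.
Qed.

Lemma needle_err_ge (H : {set 'I_n}) alpha :
  2^-1 - \sum_(x | out x == true) pmass (@unif R n t) x
    - \sum_(x | out x == false) pmass (half_hit R H alpha) x <=
  \sum_(i in H) \sum_x pmass unif x *
     - ln (lik R (ends (lo H i) (hi H i)) i alpha (ends (lo H i) (hi H i) x)).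
Proof.
apply: le_trans (half_sub_err_le (g := needle_lik H alpha) _ _ _ _ _ _) _ => //.
- exact: needle_lik_gt0.
- exact: sum_pmass_unif.
- exact: sum_pmass_half_hit.
- by move=> x; exact: pmass_half_hit_ge0.
- by move=> b; exact: pmass_half_hit_lik.
rewrite exchange_big/=; apply: ler_sum => x _.
rewrite -mulr_sumr sumrN ln_prod// => i; exact: lik_gt0.
Qed.

(** With [d] the indicator of [x i = alpha], [p d + (1 - p) / t = 2 p (d + 1 / t) / 2 + (1 - 2 p) /
    t]; expanding the product over positions produces the sum over [H]. *)
Lemma D1_prob_half_hit (p : R) x :
  D1_prob p x = \sum_H hit_mass (2 * p) H *
    (t%:R^-1 * \sum_alpha pmass (half_hit R H alpha) x).
Proof.
under [RHS]eq_bigr do rewrite mulrCA mulr_sumr.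
rewrite -mulr_sumr exchange_big/= /D1_prob mulr_sumr; apply: eq_bigr => alpha _.
congr (_ * _); rewrite /D1_cond_prob.
rewrite (eq_bigr (fun i => 2 * p * (((x i == alpha)%:R + t%:R^-1) / 2) +
    (1 - 2 * p) * t%:R^-1)) => [|i _]; last by field; rewrite pnatr_eq0 -lt0n.
rewrite bigA_distr; apply: eq_bigr => H _; rewrite -big_split/=.
by apply: eq_bigr => i _; rewrite /half_hit; case: ifP.
Qed.

(** Average [needle_err_ge] over [H] and [alpha], with [q = 2 * p] in [sum_lo_hi_le]. Gibbs'
    inequality supplies [B], as [ends] takes values in [S * S]. *)
Lemma streaming_err_ge (p : R) : 0 < p -> 2 * p <= 1 ->
  2^-1 - ln (#|S|%:R ^+ 2) * (10 * p + 16 * p ^+ 2 * n%:R) <=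
  \sum_(x | out x == true) D0_prob R x + \sum_(x | out x == false) D1_prob p x.
Proof.
move=> p0 p2.
have q0 : 0 <= 2 * p by rewrite mulr_ge0// ltW.
pose e0 := \sum_(x | out x == true) pmass (@unif R n t) x.
pose e1 H alpha := \sum_(x | out x == false) pmass (half_hit R H alpha) x.
pose J i a b := t%:R^-1 * \sum_alpha \sum_x pmass unif x *
     - ln (lik R (ends a b) i alpha (ends a b x)).
have t1 (c : R) : t%:R^-1 * \sum_(alpha < t) c = c.
  by rewrite sumr_const card_ord -[c *+ t]mulr_natl mulKf// pnatr_eq0 -lt0n.
have D1E : \sum_(x | out x == false) D1_prob p x =
    \sum_H hit_mass (2 * p) H * (t%:R^-1 * \sum_alpha e1 H alpha).
  under eq_bigr do rewrite D1_prob_half_hit.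
  rewrite exchange_big; apply: eq_bigr => H _ /=.
  by rewrite -mulr_sumr -mulr_sumr exchange_big.
have main : \sum_(H : {set 'I_n}) hit_mass (2 * p) H *
    (t%:R^-1 * \sum_(alpha < t) (2^-1 - e0 - e1 H alpha)) <=
    ln (#|S|%:R ^+ 2) * (10 * p + 16 * p ^+ 2 * n%:R).
  have -> : 10 * p + 16 * p ^+ 2 * n%:R = 5 * (2 * p) + 4 * (2 * p) ^+ 2 * n%:R by ring.
  apply: (le_trans _ (sum_lo_hi_le q0 p2 (J := J) _ _ _)).
  - apply: ler_sum => H _; rewrite ler_wpM2l ?hit_mass_ge0//.
    rewrite /J -mulr_sumr ler_wpM2l ?invr_ge0//.
    rewrite exchange_big/=; apply: ler_sum => alpha _; exact: needle_err_ge.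
  - by move=> i a b; exact: mean_neg_ln_lik_ge0.
  - move=> a b; apply: le_trans (sum_neg_ln_lik_le R (ends a b) t0) _.
    by rewrite card_prod natrM.
  case: (posnP #|S|) => [->|S0]; first by rewrite expr0n ln0.
  by rewrite ln_ge0// -natrX ler1n expn_gt0 S0.
move: main; rewrite (eq_bigr (fun H => hit_mass (2 * p) H * (2^-1 - e0) -
    hit_mass (2 * p) H * (t%:R^-1 * \sum_alpha e1 H alpha))); last first.
  by move=> H _; rewrite sumrB mulrBr t1 mulrBr.
rewrite sumrB -mulr_suml sum_hit_mass mul1r -D1E.
have -> : \sum_(x | out x == true) D0_prob R x = e0 by [].
lra.
Qed.

End Transcript.

(** * Memory states of a streaming algorithm at the cuts *)

Lemma eq_foldl_in (T : eqType) (S : Type) (f g : S -> T -> S) (z : S) (r : seq T) :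
  (forall y i, i \in r -> f y i = g y i) -> foldl f z r = foldl g z r.
Proof.
elim: r z => //= i r IH z fg; rewrite fg ?mem_head// IH// => y j jr.
by rewrite fg// inE jr orbT.
Qed.

Lemma mem_take_enum_ord n l (i : 'I_n) : (i \in take l (enum 'I_n)) = (i < l)%N.
Proof. by rewrite in_take ?mem_enum// index_enum_ord. Qed.

Lemma mem_drop_take_enum_ord n a l (i : 'I_n) : (a <= l)%N ->
  i \in drop a (take l (enum 'I_n)) -> (a <= i < l)%N.
Proof.
move=> al id; have := mem_drop id; rewrite mem_take_enum_ord => ->; rewrite andbT.
have := take_uniq l (enum_uniq 'I_n).
rewrite -{1}(cat_take_drop a (take l _)) cat_uniq => /and3P[_ /hasPn/(_ _ id) + _].
by rewrite /= take_takel// mem_take_enum_ord -leqNgt.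
Qed.

Section Algorithm.
Variables (t n k s : nat) (Omega : finType) (M : streaming_alg t n k s Omega) (w : Omega).
Implicit Types (x y : stream n t) (j : 'I_k).

Let prefix j l x st :=
  foldl (fun st i => sa_step M w j i st (x i)) st (take l (enum 'I_n)).

Let start (m : nat) x :=
  foldl (fun st j => run_pass M w j x st) (sa_init M w) (take m (enum 'I_k)).

Definition cut_state (l : nat) x : {ffun 'I_k -> 'I_(2 ^ s)} :=
  [ffun j : 'I_k => prefix j l x (start j x)].

Let prefix_split j a b x st : (a <= b)%N -> prefix j b x st =
  foldl (fun st i => sa_step M w j i st (x i)) (prefix j a x st)
    (drop a (take b (enum 'I_n))).
Proof. by move=> ab; rewrite /prefix -foldl_cat -{1}(take_takel _ ab) cat_take_drop. Qed.

Let run_pass_prefix j x st : run_pass M w j x st = prefix j n x st.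
Proof. by rewrite /run_pass /prefix take_oversize// size_enum_ord. Qed.

Let start_succ j x : start j.+1 x = prefix j n x (start j x).
Proof.
by rewrite /start (take_nth j) ?size_enum_ord// nth_ord_enum foldl_rcons run_pass_prefix.
Qed.

Let run_alg_start x : run_alg M w x = start k x.
Proof. by rewrite /run_alg /start take_oversize// size_enum_ord. Qed.

Section Splice.
Variables (a b : nat) (x y : stream n t).
Hypotheses (ab : (a <= b)%N) (Va : cut_state a x = cut_state a y).
Hypothesis Vb : cut_state b x = cut_state b y.
Let z := splice a b x y.

Let zx (i : 'I_n) : (i < a)%N || (b <= i)%N -> z i = x i.
Proof. by move=> h; rewrite ffunE; case: ifP => //; lia. Qed.

Let zy (i : 'I_n) : (a <= i < b)%N -> z i = y i.
Proof. by move=> h; rewrite ffunE h. Qed.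

(** Up to [a] the pass reads [x] and reaches the state common to [x] and [y]; on [[a, b)] it follows
    [y] into the state at [b], again common to both; from there it follows [x]. *)
Let prefix_splice j l : start j z = start j x -> (l <= a)%N || (b <= l)%N ->
  prefix j l z (start j z) = prefix j l x (start j x).
Proof.
move=> sj; have low m : (m <= a)%N -> prefix j m z (start j z) = prefix j m x (start j x).
  move=> ma; rewrite sj; apply: eq_foldl_in => st i; rewrite mem_take_enum_ord => im.
  by rewrite zx//; lia.
have hib : prefix j b z (start j z) = prefix j b x (start j x).
  have := congr1 (fun f : {ffun _ -> _} => f j) Vb; rewrite !ffunE => ->.
  rewrite !(@prefix_split j a b)// low//.
  have := congr1 (fun f : {ffun _ -> _} => f j) Va; rewrite !ffunE => ->.
  apply: eq_foldl_in => st i /(mem_drop_take_enum_ord ab) iab; by rewrite zy.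
case/orP => [/low//|bl]; rewrite !(@prefix_split j b l)// hib.
apply: eq_foldl_in => st i /(mem_drop_take_enum_ord bl) ibl.
by rewrite zx//; lia.
Qed.

Let start_splice m : (m <= k)%N -> (b <= n)%N -> start m z = start m x.
Proof.
elim: m => [|m IH] mk bn; first by rewrite /start !take0.
have := @start_succ (Ordinal mk); rewrite /= => h; rewrite !h.
by apply: prefix_splice; [exact: IH (ltnW mk) bn|rewrite bn orbT].
Qed.

Lemma cut_state_splice l : (b <= n)%N -> (l <= a)%N || (b <= l)%N ->
  cut_state l z = cut_state l x.
Proof.
move=> bn lab; apply/ffunP => j; rewrite !ffunE prefix_splice//.
by rewrite start_splice// ltnW.
Qed.

Lemma alg_output_splice : (b <= n)%N -> alg_output M w z = alg_output M w x.
Proof. by move=> bn; rewrite /alg_output !run_alg_start start_splice. Qed.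

End Splice.

(** Without passes nothing is read, and with [s = 0] there is only one state. *)
Lemma alg_output_const : (k * s = 0)%N ->
  forall x y, alg_output M w x = alg_output M w y.
Proof.
move=> /eqP; rewrite muln_eq0 => ks x y; rewrite /alg_output; congr (sa_out M w _).
case/orP: ks => [/eqP k0|/eqP s0].
  by rewrite !run_alg_start /start (size0nil (_ : size (take k _) = 0%N)) ?size_takel ?size_enum_ord.
have val0 (u : 'I_(2 ^ s)) : val u = 0%N.
  by apply/eqP; rewrite -leqn0 -ltnS (leq_trans (ltn_ord u))// s0.
by apply: val_inj; rewrite !val0.
Qed.

End Algorithm.

Lemma ln_card_states_le (R : realType) (k s : nat) :
  ln (#|{ffun 'I_k -> 'I_(2 ^ s)}|%:R ^+ 2 : R) <= 2 * (k%:R * s%:R).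
Proof.
rewrite card_ffun !card_ord -expnM -natrX -expnM natrX lnXn ?ltr0n//.
have := @ln_le_subr1 R 2; rewrite ltr0n => /(_ isT) h.
have -> : 2 * (k%:R * s%:R) = 1 *+ (s * k * 2) :> R by rewrite !natrM; ring.
by rewrite lerMn2r; apply/orP; right; lra.
Qed.

(** * Direct comparison of the two distributions *)

Section Distributions.
Variables (R : realType) (n t : nat).
Hypothesis t0 : (0 < t)%N.
Implicit Types (x : stream n t) (p : R).

Lemma sum_D0_prob : \sum_(x : stream n t) D0_prob R x = 1 :> R.
Proof. exact: sum_pmass_unif. Qed.

Lemma sum_D1_prob p : \sum_(x : stream n t) D1_prob p x = 1.
Proof.
rewrite /D1_prob exchange_big/= (eq_bigr (fun=> t%:R^-1)) => [|alpha _].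
  by rewrite sumr_const card_ord -[LHS]mulr_natl mulfV ?pnatr_eq0 -?lt0n.
rewrite -mulr_sumr -(bigA_distr_bigA (fun i a => p * (a == alpha)%:R + (1 - p) * t%:R^-1)).
rewrite big1 ?mulr1// => i _; rewrite big_split/= -!mulr_sumr sum_delta.
by rewrite sumr_const card_ord -[_ *+ t]mulr_natl mulfV ?pnatr_eq0 -?lt0n//; ring.
Qed.

Lemma bernoulli_ineq p m : 0 <= p -> p <= 1 -> 1 - p * m%:R <= (1 - p) ^+ m.
Proof.
move=> p0 p1; elim: m => [|m IH]; first by rewrite mulr0 subr0 expr0.
rewrite exprS; apply: le_trans (ler_wpM2l _ IH); last by rewrite subr_ge0.
rewrite -natr1; have : 0 <= p * p * m%:R by rewrite !mulr_ge0.
nra.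
Qed.

(** Dropping the needle term in every factor leaves [(1 - p) ^+ n] times the uniform mass: the event
    that no position is a hit. *)
Lemma D1_prob_ge p x : 0 <= p -> p <= 1 -> (1 - p * n%:R) * D0_prob R x <= D1_prob p x.
Proof.
move=> p0 p1; have D00 : 0 <= D0_prob R x by rewrite prodr_ge0// => i _; rewrite invr_ge0.
apply: (@le_trans _ _ ((1 - p) ^+ n * D0_prob R x)).
  by rewrite ler_wpM2r// bernoulli_ineq.
have cond alpha : (1 - p) ^+ n * D0_prob R x <= D1_cond_prob p alpha x.
  rewrite -[X in _ ^+ X]card_ord -prodr_const -big_split/=; apply: ler_prod => i _.
  by rewrite mulr_ge0 ?subr_ge0 ?invr_ge0//= lerDr mulr_ge0.
rewrite /D1_prob -mulr_sumr mulrC ler_pdivlMl ?ltr0n//.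
apply: le_trans (_ : \sum_(alpha < t) (1 - p) ^+ n * D0_prob R x <= _); last first.
  by apply: ler_sum => alpha _; exact: cond.
by rewrite sumr_const card_ord mulr_natl mulrC.
Qed.

End Distributions.

(** * Error for a fixed seed, and the lower bound *)

Section Error.
Variables (R : realType) (t n k s : nat) (p : R) (Omega : finType).
Variable M : streaming_alg t n k s Omega.

Definition seed_err (w : Omega) : R :=
  \sum_(x | alg_output M w x == true) D0_prob R x +
  \sum_(x | alg_output M w x == false) D1_prob p x.

Lemma PrD0_PrD1_seed_err (mu : Omega -> R) :
  PrD0 mu M true + PrD1 p mu M false = \sum_w mu w * seed_err w.
Proof.
rewrite /PrD0 /PrD1 -big_split/=; apply: eq_bigr => w _.
rewrite mulrDr !mulr_sumr; congr (_ + _); rewrite [RHS]big_mkcond/=; apply: eq_bigr => x _.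
  by case: eqP; rewrite ?mulr1 ?mulr0.
by case: eqP; rewrite ?mulr1 ?mulr0.
Qed.

Lemma seed_err_le (mu : Omega -> R) (v e : R) : is_distr mu ->
  (forall w, v <= seed_err w) -> PrD0 mu M true + PrD1 p mu M false <= e -> v <= e.
Proof.
move=> [mu0 mu1] vw; rewrite PrD0_PrD1_seed_err; apply: le_trans.
rewrite -[v]mul1r -mu1 mulr_suml; apply: ler_sum => w _; exact: ler_wpM2l.
Qed.

Hypotheses (t0 : (0 < t)%N) (p0 : 0 < p) (p1 : p <= 1).

Lemma seed_err_ge w : 2 * p <= 1 ->
  2^-1 - 2 * (k%:R * s%:R) * (10 * p + 16 * p ^+ 2 * n%:R) <= seed_err w.
Proof.
move=> p2; apply: le_trans (@streaming_err_ge R n t _ (cut_state M w) _ t0 _ _ p p0 p2).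
- rewrite lerD2l lerN2 ler_wpM2r ?ln_card_states_le//.
  by rewrite addr_ge0// !mulr_ge0 ?exprn_ge0// ltW.
- by move=> a b x y l /andP[ab bn] [Va Vb] lab; exact: cut_state_splice.
by move=> a b x y /andP[ab bn] [Va Vb]; exact: alg_output_splice.
Qed.

Let split_out w (F : stream n t -> R) : \sum_x F x =
  \sum_(x | alg_output M w x == true) F x + \sum_(x | alg_output M w x == false) F x.
Proof.
by rewrite (bigID (alg_output M w))/=; congr (_ + _); apply: eq_bigl => x; case: alg_output.
Qed.

(** Here the needle law has at least half the uniform mass at every stream, so the two errors
    together are at least half the total uniform mass. *)
Lemma seed_err_ge_sparse w : p * n%:R <= 2^-1 -> 2^-1 <= seed_err w.
Proof.
move=> pn; have D00 (x : stream n t) : 0 <= D0_prob R x.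
  by rewrite prodr_ge0// => i _; rewrite invr_ge0.
have s1 := sum_D0_prob R n t0; rewrite (split_out w) in s1.
have h : 2^-1 * \sum_(x | alg_output M w x == false) D0_prob R x <=
    \sum_(x | alg_output M w x == false) D1_prob p x.
  rewrite mulr_sumr; apply: ler_sum => x _.
  apply: le_trans (D1_prob_ge t0 x (ltW p0) p1); rewrite ler_wpM2r//; lra.
have : 0 <= \sum_(x | alg_output M w x == true) D0_prob R x by rewrite sumr_ge0.
rewrite /seed_err; lra.
Qed.

Lemma seed_err_ge_memoryless w : (k * s = 0)%N -> 2^-1 <= seed_err w.
Proof.
move=> ks; have s1 := sum_D0_prob R n t0; have s2 := sum_D1_prob n t0 p.
have [x0 _|noS] := pickP (@predT (stream n t)); last first.
  by move: s1; rewrite big_pred0// => /esym/eqP; rewrite oner_eq0.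
have outE x : alg_output M w x = alg_output M w x0 by exact: alg_output_const.
rewrite /seed_err (eq_bigl (fun=> alg_output M w x0 == true)); last by move=> x; rewrite outE.
rewrite [X in _ + X](eq_bigl (fun=> alg_output M w x0 == false)); last by move=> x; rewrite outE.
case: (alg_output M w x0) => /=; first by rewrite s1 big_pred0_eq; lra.
by rewrite s2 big_pred0_eq; lra.
Qed.

End Error.

Theorem theorem1p9 :
  exists eps0 c : rat, 0 < eps0 /\ 0 < c /\
  forall (R : realType) (t n k s : nat) (p : R) (Omega : finType) (mu : Omega -> R)
         (M : streaming_alg t n k s Omega),
    (0 < t)%N ->
    (100 * n <= t)%N ->
    0 < p -> p <= 1 ->
    is_distr mu ->
    PrD0 mu M true + PrD1 p mu M false <= ratr eps0 ->
    ratr c <= k%:R * s%:R * p ^+ 2 * n%:R.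
Proof.
(* When [p n > 1/2], [p <= 2 p^2 n], so [2 k s (10 p + 16 p^2 n) <= 72 k s p^2 n]. This must be at
   least [1/2 - 1/4], and [4 * 72 = 288]. *)
exists 4^-1, 288^-1; split; first by rewrite invr_gt0 ltr0n.
split; first by rewrite invr_gt0 ltr0n.
move=> R t n k s p Omega mu M t0 _ p0 p1 mu1.
have ratr_invn m : ratr m%:R^-1 = m%:R^-1 :> R by rewrite fmorphV rmorph_nat.
rewrite (ratr_invn 4%N) (ratr_invn 288%N) => err.
have [pn|pn] := leP (p * n%:R) 2^-1.
  exfalso; have := seed_err_le mu1 (fun w => seed_err_ge_sparse M t0 p0 p1 w pn) err.
  lra.
have [p2|p2] := leP (2 * p) 1.
  have := seed_err_le mu1 (fun w => seed_err_ge M t0 p0 w p2) err.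
  have pp : p <= 2 * (p ^+ 2 * n%:R).
    by have := ler_wpM2l (ltW p0) (ltW pn); rewrite expr2; nra.
  have ks0 : 0 <= k%:R * s%:R :> R by rewrite mulr_ge0.
  have := ler_wpM2l ks0 pp; lra.
(* For [p > 1/2], [2 p] is no longer a probability, but [p n > 1/2] already gives [p^2 n >= 1/4]; it
   remains to exclude [k s = 0]. *)
have [ks|ks] := posnP (k * s).
  exfalso; have := seed_err_le mu1 (fun w => seed_err_ge_memoryless p M t0 w ks) err.
  lra.
have ks1 : 1 <= k%:R * s%:R :> R by rewrite -natrM ler1n.
have h : 4^-1 <= p ^+ 2 * n%:R by rewrite expr2; nra.
rewrite -mulrA; nra.
Qed.
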